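(* Let $X$ be a compact metric space with metric $d$. If a continuous map $f\colon X\to X$ has the shadowing property, then $X=\overline{\mathbb{A}(f)}$, i.e. $\mathbb{A}(f)$ is a dense subset of $X$.
   Context: Let $X$ be a compact metric space with metric $d$ and $f\colon X\to X$ a continuous map. For $\delta>0$, a sequence $(x_i)_{i\ge0}$ of points in $X$ is a $\delta$-pseudo orbit of $f$ if $d(f(x_i),x_{i+1})\le\delta$ for all $i\ge0$. For $\epsilon>0$, a sequence $(x_i)_{i\ge0}$ of points in $X$ is $\epsilon$-shadowed by $x\in X$ if $d(f^i(x),x_i)\le\epsilon$ for all $i\ge0$. The map $f$ has the shadowing property if for any $\epsilon>0$ there is $\delta>0$ such that every $\delta$-pseudo orbit of $f$ is $\epsilon$-shadowed by some point of $X$. A subset $S\subset X$ is $f$-invariant if $f(S)\subset S$. For $x\in X$, the $\omega$-limit set $\omega(x,f)$ is the set of $y\in X$ such that $\lim_{j\to\infty}f^{i_j}(x)=y$ for some sequence of integers $0\le i_1<i_2<\cdots$. Odometers: given a nondecreasing sequence $m=(m_j)_{j\ge1}$ of positive integers with $m_j\mid m_{j+1}$ for all $j\ge1$ and $\lim_{j\to\infty}m_j=\infty$, let $X(j)=\{0,1,\dots,m_j-1\}$ with the discrete topology, let \[ X_m=\Big\{(x_j)_{j\ge1}\in\prod_{j\ge1}X(j)\colon x_j\equiv x_{j+1}\pmod{m_j}\text{ for all }j\ge1\Big\} \] with the subspace topology from the product space, and define $g_m\colon X_m\to X_m$ by $g_m(x)_j=x_j+1\pmod{m_j}$ for all $x=(x_j)_{j\ge1}\in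 X_m$ and $j\ge1$. The homeomorphism $g_m$ is called an odometer with periodic structure $m$. A closed $f$-invariant subset $S$ of $X$ is called an odometer if $f|_S\colon S\to S$ is topologically conjugate to such a map, i.e. there are some such $g_m\colon X_m\to X_m$ and a homeomorphism $h\colon X_m\to S$ with $f|_S\circ h=h\circ g_m$. A closed $f$-invariant subset $S$ of $X$ is a periodic orbit if there are $x\in S$ and $i>0$ such that $f^i(x)=x$ and $S=\{x,f(x),\dots,f^{i-1}(x)\}$. $\mathbb{A}(f)$ denotes the set of $x\in X$ such that $\omega(x,f)$ is a periodic orbit or an odometer. *)

(* Defs.v *)
From HB Require Import structures.
From mathcomp Require Import all_boot all_order all_algebra.
From mathcomp Require Import all_classical all_reals all_analysis.

Set Implicit Arguments.
Unset Strict Implicit.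
Unset Printing Implicit Defensive.

Import Order.TTheory GRing.Theory Num.Theory.

Local Open Scope classical_set_scope.
Local Open Scope ring_scope.

Section Shadowing.
Context {R : realType} {X : metricType R}.
Implicit Types (f : X -> X) (xs : nat -> X) (x : X).

Definition pseudo_orbit f (delta : R) xs : Prop :=
  forall i, mdist (f (xs i)) (xs i.+1) <= delta.

Definition shadowed f (epsilon : R) xs x : Prop :=
  forall i, mdist (iter i f x) (xs i) <= epsilon.

Definition shadowing_property f : Prop :=
  forall epsilon : R, 0 < epsilon ->
  exists2 delta : R, 0 < delta &
    forall xs, pseudo_orbit f delta xs -> exists x, shadowed f epsilon xs x.

End Shadowing.

Definition invariant_set {T : Type} (f : T -> T) (S : set T) : Prop :=
  f @` S `<=` S.

Lemma invariant_set_mem {T : Type} (f : T -> T) (S : set T) :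
  invariant_set f S -> forall x : S, f (\val x) \in S.
Proof. by move=> fS x; apply/mem_set/fS; exists (\val x) => //; exact: set_valP. Qed.

Definition restrict_map {T : Type} (f : T -> T) (S : set T)
  (fS : invariant_set f S) (x : S) : S :=
  exist (fun y => is_true (y \in S)) (f (\val x)) (invariant_set_mem fS x).

Definition homeomorphism {T U : topologicalType} (h : T -> U) : Prop :=
  continuous h /\
  exists k : U -> T, [/\ cancel h k, cancel k h & continuous k].

Definition topologically_conjugate {T U : topologicalType}
    (g : T -> T) (f : U -> U) : Prop :=
  exists2 h : T -> U, homeomorphism h & f \o h = h \o g.

(* Indices start at 0: [m j] is the (j+1)-st term of the sequence. *)
Record periodic_structure := PeriodicStructure {
  period :> nat -> nat;
  period_gt0 : forall j, (0 < period j)%N;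
  period_nondecreasing : {homo period : i j / (i <= j)%N >-> (i <= j)%N};
  period_dvd : forall j, (period j %| period j.+1)%N;
  period_cvg : period @ \oo --> \oo }.

Section Odometer.
Variable m : periodic_structure.

Definition odometer_ambient : Type :=
  prod_topology (fun j : nat => discrete_topology 'I_(m j)).

Definition odometer_space : set odometer_ambient :=
  [set x | forall j, (x j : 'I_(m j)) = (x j.+1 : 'I_(m j.+1)) %[mod m j]].

(* [ordS i] has value [i.+1 %% m j]. *)
Definition odometer_succ (x : odometer_ambient) : odometer_ambient :=
  fun j => ordS (x j : 'I_(m j)).

Lemma odometer_succ_invariant : invariant_set odometer_succ odometer_space.
Proof.
move=> _ [x xm <-] j; rewrite /odometer_succ /= modn_mod.
by rewrite modn_dvdm ?period_dvd// -addn1 -[in RHS]addn1 -modnDml xm modnDml.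
Qed.

Definition odometer_map : odometer_space -> odometer_space :=
  restrict_map odometer_succ_invariant.

End Odometer.

Section LimitSets.
Context {X : topologicalType}.
Implicit Types (f : X -> X) (x : X) (S : set X).

Definition omega_limit f x : set X :=
  [set y | exists2 i : nat -> nat,
     {homo i : j k / (j < k)%N >-> (j < k)%N} &
     iter (i j) f x @[j --> \oo] --> y].

Definition is_odometer f S : Prop :=
  closed S /\
  exists (fS : invariant_set f S) (m : periodic_structure),
    topologically_conjugate (@odometer_map m) (restrict_map fS).

Definition is_periodic_orbit f S : Prop :=
  [/\ closed S, invariant_set f S &
      exists x (i : nat), [/\ S x, (0 < i)%N, iter i f x = x &
        S = [set iter k f x | k in [set k | (k < i)%N]]]].

(* The set denoted $\mathbb{A}(f)$. *)
Definition omega_regular_points f : set X :=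
  [set x | is_periodic_orbit f (omega_limit f x) \/
           is_odometer f (omega_limit f x)].

End LimitSets.

(* Main.v *)
(* Given x and e > 0, use shadowing to build points y_0, y_1, ... near x, the
   orbit of y_(n+1) shadowing a pseudo-orbit that follows the orbit of y_n up to
   a near-return at a time divisible by m_n and then repeats the loop between
   the two visits forever.  The loop length m_(n+1) is a multiple of m_n, and
   the orbits of the y_n converge uniformly in time, so their limit y satisfies
   d(f^i y, f^j y) <= e_n as soon as i, j are large and congruent modulo m_n,
   with e_n -> 0.  Then omega(y) is the orbit closure of a point z with the same
   property for all i, j >= 0.  The closures of {f^i z : i = c mod m_n} are
   pairwise equal or disjoint, and equality depends only on c modulo some
   divisor d_n of m_n.  Since these closures have small diameter, reading off
   the classes modulo d_n identifies omega(y) with the odometer of structure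
   (d_n), unless z is periodic. *)
Require Import Defs.
From mathcomp Require Import all_boot all_order all_algebra.
From mathcomp Require Import all_classical all_reals all_analysis.
From mathcomp Require Import zify lra.

Set Implicit Arguments.
Unset Strict Implicit.
Unset Printing Implicit Defensive.

Import Order.TTheory GRing.Theory Num.Theory.

Local Open Scope classical_set_scope.
Local Open Scope ring_scope.

Lemma dvdn_homo (m : nat -> nat) : (forall n, m n %| m n.+1)%N ->
  {homo m : n N / (n <= N)%N >-> (n %| N)%N}.
Proof. by move=> mS; apply: homo_leq => [//|k l n|//]; exact: dvdn_trans. Qed.

(** * Metric criteria for neighbourhoods, closures and omega-limit sets *)

Section MetricSpaces.
Context {R : realType} {X : metricType R}.
Implicit Types (g : X -> X) (A : set X) (x y : X).

Lemma nbhs_mdistP x A :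
  nbhs x A <-> exists2 e : R, 0 < e & forall y, mdist x y < e -> A y.
Proof.
split=> [/nbhs_ballP[e /= e0 xeA]|[e e0 xeA]].
  by exists e => // y xy; apply: xeA; rewrite ballEmdist.
by apply/nbhs_ballP; exists e => //= y; rewrite ballEmdist; exact: xeA.
Qed.

Lemma continuous_mdist g x (e : R) : continuous g -> 0 < e ->
  exists2 de : R, 0 < de & forall y, mdist x y < de -> mdist (g x) (g y) < e.
Proof.
move=> cg e0; apply/nbhs_mdistP; apply: (cg x (fun z => mdist (g x) z < e)).
by apply/nbhs_mdistP; exists e.
Qed.

Lemma continuous_iter g k : continuous g -> continuous (iter k g).
Proof.
move=> cg; elim: k => [|k IHk] x /=; first exact: cvg_id.
by apply: (continuous_comp (IHk x)); exact: cg.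
Qed.

Lemma closure_mdistP A x :
  closure A x <-> forall e : R, 0 < e -> exists2 y, A y & mdist x y < e.
Proof.
split=> [clAx e e0|Ax B /nbhs_mdistP[e e0 xeB]].
  have [y [Ay xy]] : A `&` [set y | mdist x y < e] !=set0.
    by apply: clAx; apply/nbhs_mdistP; exists e.
  by exists y.
by have [y Ay xy] := Ax _ e0; exists y; split=> //; exact: xeB.
Qed.

(** A cluster point of the sequence, used in place of the limit of a convergent subsequence. *)
Lemma compact_frequently_near (u : nat -> X) : compact [set: X] ->
  exists p, forall (e : R) N, 0 < e -> exists2 n, (N <= n)%N & mdist p (u n) < e.
Proof.
move=> cX; have [p [_ pu]] : [set: X] `&` cluster (u @ \oo) !=set0.
  by apply: cX; exact: filterT.
exists p => e N e0.
have [_ [[n /= Nn <-] pun]] :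
    (u @` [set n | (N <= n)%N]) `&` [set y | mdist p y < e] !=set0.
  apply: pu; last by apply/nbhs_mdistP; exists e.
  by exists N => // n /= Nn; exists n.
by exists n.
Qed.

Lemma omega_limitP g x y : omega_limit g x y <->
  forall (e : R) N, 0 < e -> exists2 n, (N <= n)%N & mdist y (iter n g x) < e.
Proof.
split=> [[i i_homo /cvg_ballP iy] e N e0|near_y].
  have [M _ My] := iy _ e0; exists (i (maxn M N)).
    have i_ge k : (k <= i k)%N.
      by elim: k => // k IHk; apply: (leq_ltn_trans IHk); exact: i_homo.
    by apply: leq_trans (i_ge _); exact: leq_maxr.
  by have := My (maxn M N) (leq_maxl _ _); rewrite ballEmdist.
have /choice[next nextP] : forall q : nat * nat, exists n,
    (q.2 < n)%N /\ mdist y (iter n g x) < (q.1.+1%:R)^-1.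
  move=> q; have [|n qn yn] := near_y (q.1.+1%:R)^-1 q.2.+1.
    by rewrite invr_gt0.
  by exists n.
(* Each index exceeds the previous one, and the k-th has tolerance 1/(k+1). *)
pose fix i k := if k is k'.+1 then next (k, i k') else next (0, 0)%N.
exists i.
  apply: homo_ltn => [k l m|k]; first exact: ltn_trans.
  exact: (nextP (k.+1, i k)).1.
apply/cvg_ballP => e e0.
near=> k; rewrite ballEmdist /=; apply: (@lt_trans _ _ (k.+1%:R^-1)).
  case: (k) => [|k'] /=; first exact: (nextP (0, 0)%N).2.
  exact: (nextP (k'.+1, _)).2.
by near: k; exact: (near_infty_natSinv_lt (PosNum e0)).
Unshelve. all: by end_near. Qed.

End MetricSpaces.

(** * Eventually periodic time changes: a tail of length [a], then a loop of length [p] *)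

Definition lasso a p i := if (i < a)%N then i else (a + (i - a) %% p)%N.

Lemma lasso_ge a p i : (a <= i)%N -> (a <= lasso a p i)%N.
Proof. by rewrite /lasso leqNgt => /negbTE ->; exact: leq_addr. Qed.

Lemma lasso_mod a p i : lasso a p i = i %[mod p].
Proof. by rewrite /lasso; case: ltnP => // ai; rewrite modnDmr subnKC. Qed.

Lemma eq_lasso a p i j : (a <= i)%N -> (a <= j)%N -> i = j %[mod p] ->
  lasso a p i = lasso a p j.
Proof.
move=> ai aj ij; rewrite /lasso !ltnNge ai aj /=; congr (_ + _)%N.
by apply/eqP; rewrite -(eqn_modDl a) !subnKC //; exact/eqP.
Qed.

(** An orbit reparametrized by [lasso] is a true orbit except at the wrap from [a + p - 1] to [a],
    so only that jump has to be small in a pseudo orbit. *)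
Lemma lassoS a p i : (0 < p)%N ->
  lasso a p i.+1 = (lasso a p i).+1 \/
  (lasso a p i).+1 = (a + p)%N /\ lasso a p i.+1 = a.
Proof.
move=> p0; rewrite /lasso; have [ia|ai] := ltnP i a.
  by left; case: ltnP => // ai; rewrite (_ : i.+1 = a) ?subnn ?mod0n ?addn0//; lia.
rewrite ltnNge (leqW ai) /= subSn // modnS; case: ifPn => pdvd; last first.
  by left; rewrite addnS.
right; split; last by rewrite addn0.
have : p = ((i - a) %% p).+1; last lia.
apply/eqP; rewrite eqn_leq ltn_pmod // andbT dvdn_leq //.
by move: pdvd; rewrite /dvdn -[(_ %% _).+1]addn1 modnDml addn1.
Qed.

(** * Construction of a regular orbit by shadowing *)

Section AlmostPeriodic.
Context {R : realType} {X : metricType R} (f : X -> X).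
Implicit Types (x y z : X) (e : R).

(** Regular recurrence at the single scale [e], after a transient of length [a]. *)
Definition almost_periodic e y a m := forall i j,
  (a <= i)%N -> (a <= j)%N -> i = j %[mod m] ->
  mdist (iter i f y) (iter j f y) <= e.

Lemma mdist_triangle3 x y z w :
  mdist x w <= mdist x y + mdist y z + mdist z w.
Proof.
by apply: le_trans (metric_triangle _ z _) _; rewrite lerD2r metric_triangle.
Qed.

Hypothesis cX : compact [set: X].
Hypothesis shadowf : shadowing_property f.

(** Two visits to a small ball, at times congruent to [a] modulo [m], bound a loop whose repetition
    is a pseudo orbit. Congruent late times have the same [lasso] value, so two shadowing errors
    give the bound [e *+ 2]. *)
Lemma shadow_lasso y a m e : 0 < e -> (0 < m)%N ->
  exists y' a' m', [/\ (0 < m')%N, (a <= a')%N, (m %| m')%N,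
    almost_periodic (e *+ 2) y' a' m' &
    forall i, mdist (iter i f y') (iter (lasso a' m' i) f y) <= e].
Proof.
move=> e0 m0; have [de de0 pseudo_shadow] := shadowf e0.
have [p pP] := compact_frequently_near (fun k => iter (a + k * m) f y) cX.
have de20 : 0 < de / 2 by rewrite divr_gt0.
have [k _ pk] := pP _ 0%N de20; have [l kl pl] := pP _ k.+1 de20.
pose a' := (a + k * m)%N; pose m' := ((l - k) * m)%N.
have m'0 : (0 < m')%N by rewrite muln_gt0 subn_gt0 kl.
have jump : mdist (iter (a' + m') f y) (iter a' f y) <= de.
  have -> : (a' + m' = a + l * m)%N by rewrite /a' /m'; nia.
  rewrite metric_sym (le_trans (metric_triangle _ p _)) // [in leRHS](splitr de).
  by rewrite lerD // ltW // metric_sym.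
have [|y' y'P] := pseudo_shadow (fun i => iter (lasso a' m' i) f y).
  move=> i; rewrite -iterS.
  have [->|[-> ->]//] := lassoS a' i m'0.
  by rewrite mdistxx ltW.
exists y', a', m'; split => //; rewrite ?leq_addr ?dvdn_mull // => i j ai aj ij.
rewrite (le_trans (metric_triangle _ (iter (lasso a' m' i) f y) _)) //.
by rewrite mulr2n lerD // metric_sym (eq_lasso ai aj ij).
Qed.

(* Replacing the time [i] by [lasso a' m' i] moves it only within its class
   modulo [m], so the new orbit stays uniformly close to the old one. *)
Lemma shadow_step y a m e e' : 0 < e' -> (0 < m)%N -> almost_periodic e y a m ->
  exists y' a' m', [/\ (0 < m')%N, (m %| m')%N,
    almost_periodic (e' *+ 2) y' a' m' &
    forall i, mdist (iter i f y') (iter i f y) <= e' + e].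
Proof.
move=> e'0 m0 yP.
have [y' [a' [m' [m'0 aa' mm' y'P y'y]]]] := shadow_lasso y a e'0 m0.
exists y', a', m'; split=> // i.
rewrite (le_trans (metric_triangle _ (iter (lasso a' m' i) f y) _)) ?lerD //.
have [ia|ai] := ltnP i a.
  rewrite /lasso (leq_trans ia aa') mdistxx.
  (* The instance of [yP] at [a], [a] serves only to show that [e] is nonnegative. *)
  by rewrite (le_trans _ (yP a a _ _ _)) ?mdist_ge0.
apply: yP => //.
  have [ia'|ai'] := ltnP i a'; first by rewrite /lasso ia'.
  by rewrite (leq_trans aa') // lasso_ge.
by rewrite -[LHS](modn_dvdm _ mm') lasso_mod modn_dvdm.
Qed.

Lemma exists_regular x e : continuous f -> 0 < e ->
  exists y (a m : nat -> nat), [/\ mdist x y <= e, forall n, (0 < m n)%N,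
    forall n, (m n %| m n.+1)%N &
    forall n, almost_periodic (e / 2 ^+ n) y (a n) (m n)].
Proof.
move=> cf e0.
(* 14 = 6 + 2 + 6: the limit stays within [de n *+ 6] of stage n at both times compared, and stage n
   is almost periodic up to [de n *+ 2]. *)
pose de n : R := e / 2 ^+ n / 14.
have de0 n : 0 < de n by rewrite !divr_gt0 ?exprn_gt0.
have deS n : de n = de n.+1 *+ 2.
  by rewrite /de exprS invfM; move: (2 ^+ n)^-1 => t; lra.
pose good n (s : X * nat * nat) :=
  (0 < s.2)%N /\ almost_periodic (de n *+ 2) s.1.1 s.1.2 s.2.
(* The orbit of [x] has no almost periodicity yet, so the start uses [shadow_lasso] with modulus 1.
   Closeness to [x] is kept at time 0, which [lasso] fixes. *)
have [y0 [a0 [m0 [m00 _ _ y0P xy0]]]] := shadow_lasso x 0 (de0 0%N) (ltn0Sn 0).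
have {}xy0 : mdist x y0 <= de 0%N.
  have := xy0 0%N; rewrite metric_sym /lasso; case: ltnP => //.
  by rewrite leqn0 => /eqP ->; rewrite subnn mod0n.
have /choice[next nextP] : forall q : nat * (X * nat * nat), exists s',
    good q.1 q.2 -> [/\ good q.1.+1 s', (q.2.2 %| s'.2)%N &
      forall i, mdist (iter i f s'.1.1) (iter i f q.2.1.1) <=
        de q.1.+1 + de q.1 *+ 2].
  move=> [n [[y a] m]].
  (* A state that is not good gets itself as a dummy successor, so that [next] is total. *)
  case: (pselect (good n (y, a, m))) => [[/= m_gt0 yP]|]; last first.
    by exists (y, a, m).
  have [y' [a' [m' [m'0 mm' y'P y'y]]]] := shadow_step (de0 n.+1) m_gt0 yP.
  by exists (y', a', m').
pose fix s n := if n is n'.+1 then next (n', s n') else (y0, a0, m0).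
have goods n : good n (s n) by elim: n => // n IHn; have [] := nextP (n, s n) IHn.
pose u n := (s n).1.1; pose a n := (s n).1.2; pose m n := (s n).2.
have u_step n i : mdist (iter i f (u n.+1)) (iter i f (u n)) <= de n *+ 3.
  have [_ _ /(_ i)] := nextP (n, s n) (goods n); move=> /le_trans; apply => /=.
  by rewrite (deS n); have := de0 n.+1; lra.
(* Steps of size at most [de n *+ 3] with [de] halving sum to [de n *+ 6]; the subtracted term makes
   the induction telescope. *)
have u_dist n k i : mdist (iter i f (u (n + k)%N)) (iter i f (u n)) <=
    de n *+ 6 - de (n + k)%N *+ 6.
  elim: k => [|k IHk]; first by rewrite addn0 mdistxx subrr.
  rewrite addnS (le_trans (metric_triangle _ (iter i f (u (n + k)%N)) _)) //.
  have := u_step (n + k)%N i; rewrite [de (n + k)%N]deS in IHk *; lra.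
have [y yP] := compact_frequently_near u cX.
(* A cluster point suffices: all stages after n obey the bound, which passes to [y] by continuity of
   the i-th iterate. *)
have y_dist n i : mdist (iter i f y) (iter i f (u n)) <= de n *+ 6.
  apply/ler_addgt0Pl => eta eta0.
  have [r r0 yr] := continuous_mdist y (@continuous_iter _ _ _ i cf) eta0.
  have [N nN yN] := yP r n r0.
  rewrite (le_trans (metric_triangle _ (iter i f (u N)) _)) // lerD //.
    exact/ltW/yr.
  have := u_dist n (N - n)%N i; rewrite subnKC // => /le_trans; apply.
  by rewrite lerBlDr lerDl mulrn_wge0 // ltW.
have de14 n : e / 2 ^+ n = de n *+ 14 by rewrite /de; move: (_ / _) => t; lra.
exists y, a, m; split.
- rewrite (le_trans (metric_triangle _ y0 _)) //.
  have y0y : mdist y0 y <= de 0%N *+ 6.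
    by rewrite metric_sym; exact: y_dist 0%N 0%N.
  by have := de14 0%N; rewrite expr0 divr1 => ->; have := de0 0%N; lra.
- by move=> n; have [] := goods n.
- by move=> n; have [] := nextP (n, s n) (goods n).
- move=> n i j ai aj ij; rewrite de14.
  have [_ /(_ i j ai aj ij) uij] := goods n.
  have := y_dist n i; have := y_dist n j; rewrite [X in X <= _]metric_sym => yj yi.
  rewrite (le_trans (mdist_triangle3 _ (iter i f (u n)) (iter j f (u n)) _)) //.
  by rewrite /u in yi yj *; lra.
Qed.

End AlmostPeriodic.

(** The modulus [d] is the least positive number equivalent to 0. Equivalent residues i < j < d,
    shifted by d - i, would make the smaller positive number j - i equivalent to 0. *)
Lemma shift_invariant_equivalence (E : nat -> nat -> Prop) m :
  (forall i, E i i) -> (forall i j, E i j -> E j i) ->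
  (forall i j k, E i j -> E j k -> E i k) ->
  (forall i j k, E i j -> E (i + k)%N (j + k)%N) ->
  (0 < m)%N -> E 0%N m ->
  exists2 d, (0 < d)%N & forall i j, E i j <-> i = j %[mod d].
Proof.
move=> Erefl Esym Etrans Eshift m0 E0m.
have [d /andP[d0 /asboolP E0d] dmin] :
    {d | (0 < d)%N && `[< E 0%N d >] &
         forall k, (0 < k)%N && `[< E 0%N k >] -> (d <= k)%N}.
  have ex : exists d, (0 < d)%N && `[< E 0%N d >].
    by exists m; rewrite m0; exact/asboolP.
  by exists (ex_minn ex); case: ex_minnP.
have Emul q i : E i (i + q * d)%N.
  elim: q i => [|q IHq] i; first by rewrite addn0.
  apply: (Etrans _ _ _ (IHq _)); rewrite mulSn addnCA.
  by have := Eshift _ _ (i + q * d)%N E0d; rewrite add0n.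
have Emod i : E (i %% d)%N i.
  by rewrite {2}(divn_eq i d) addnC; exact: Emul.
have Esmall i j : (i <= j)%N -> (j < d)%N -> E i j -> i = j.
  move=> ij jd Eij; case: (posnP (j - i)) => [|ji0]; first lia.
  suff /dmin : (0 < j - i)%N && `[< E 0%N (j - i)%N >] by lia.
  rewrite ji0; apply/asboolP; apply: (Etrans _ _ _ E0d).
  have := Eshift _ _ (d - i)%N Eij; rewrite subnKC; last lia.
  rewrite (_ : (j + (d - i) = (j - i) + 1 * d)%N); last lia.
  by move=> /Etrans; apply; exact/Esym/Emul.
exists d => // i j; split=> [Eij|ij]; last first.
  by apply: (Etrans _ (j %% d)%N) => //; rewrite -ij; exact/Esym/Emod.
have {}Eij : E (i %% d)%N (j %% d)%N.
  by apply: (Etrans _ _ _ (Emod i)); apply: (Etrans _ _ _ Eij); exact/Esym/Emod.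
have [ij|/ltnW ji] := leqP (i %% d) (j %% d); first exact: Esmall (ltn_pmod _ _) _.
by apply/esym/Esmall => //; [exact: ltn_pmod|exact: Esym].
Qed.

(** * Passing from a regular orbit to its omega-limit set *)

Section RegularOrbit.
Context {R : realType} {X : metricType R} (f : X -> X).
Hypothesis cf : continuous f.

(** The point [z] is a cluster point of the orbit of [y] along late times of phase 0. Its orbit
    follows that of [y] in phase without the transient; comparing two of its points through [y]
    doubles the error. *)
Lemma omega_limit_almost_periodic y (a m : nat -> nat) (eta : nat -> R) :
  compact [set: X] ->
  (forall n, (0 < m n)%N) -> (forall n, (m n %| m n.+1)%N) ->
  (forall e : R, 0 < e -> exists N, forall n, (N <= n)%N -> eta n < e) ->
  (forall n, almost_periodic f (eta n) y (a n) (m n)) ->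
  exists2 z, omega_limit f y = closure (range (fun i => iter i f z)) &
    forall n, almost_periodic f (eta n *+ 2) z 0 (m n).
Proof.
move=> cX m0 mS eta_small yP.
(* The sum puts [b n] beyond [a k] for every k <= n, as [a] need not be monotone; the factor [m n]
   gives phase 0 at all levels up to n. *)
pose b n := ((\sum_(k < n.+1) a k) * m n)%N.
have ab n N : (n <= N)%N -> (a n <= b N)%N.
  move=> nN; apply: leq_trans (leq_pmulr _ (m0 N)).
  by rewrite (bigD1 (Ordinal (nN : n < N.+1)%N)) //= leq_addr.
have [z zP] := compact_frequently_near (fun n => iter (b n) f y) cX.
have zy n c i : (a n <= i)%N -> i = c %[mod m n] ->
    mdist (iter c f z) (iter i f y) <= eta n.
  move=> ai ic; apply/ler_addgt0Pl => e e0.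
  have [r r0 zr] := continuous_mdist z (@continuous_iter _ _ _ c cf) e0.
  have [N nN zN] := zP r n r0.
  rewrite (le_trans (metric_triangle _ (iter (c + b N) f y) _)) // lerD //.
    by rewrite iterD; exact/ltW/zr.
  apply: yP => //; first by rewrite (leq_trans (ab _ _ nN)) // leq_addl.
  by rewrite /b -(divnK (dvdn_homo mS nN)) mulnA addnC modnMDl.
have a_le n c : (a n <= a n * m n + c)%N.
  by rewrite (leq_trans (leq_pmulr _ (m0 n))) // leq_addr.
exists z; last first.
  move=> n i j _ _ ij; rewrite mulr2n.
  rewrite (le_trans (metric_triangle _ (iter (a n * m n + i) f y) _)) // lerD //.
    by apply: zy => //; rewrite modnMDl.
  by rewrite metric_sym; apply: zy => //; rewrite modnMDl.
apply/seteqP; split=> w /= => [/omega_limitP|/closure_mdistP] wP.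
  apply/closure_mdistP => e e0; have e20 : 0 < e / 2 by rewrite divr_gt0.
  have [n /(_ n (leqnn n)) ne] := eta_small _ e20.
  have [i ai wi] := wP _ (a n) e20.
  exists (iter i f z) => //; apply: le_lt_trans (metric_triangle _ (iter i f y) _) _.
  rewrite (splitr e) ltrD // metric_sym; apply: le_lt_trans ne; exact: zy.
apply/omega_limitP => e N e0; have e20 : 0 < e / 2 by rewrite divr_gt0.
have [n /(_ n (leqnn n)) ne] := eta_small _ e20.
have [_ [c _ <-] wc] := wP _ e20.
exists ((a n + N) * m n + c)%N.
  by rewrite -[leqLHS]addn0 leq_add // (leq_trans _ (leq_pmulr _ (m0 n))) // leq_addl.
apply: le_lt_trans (metric_triangle _ (iter c f z) _) _.
rewrite (splitr e) ltrD //; apply: le_lt_trans ne; apply: zy; last by rewrite modnMDl.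
by rewrite mulnDl -addnA.
Qed.

(** * Closures of residue classes of the orbit *)

Context (z : X) (m : nat -> nat) (eta : nat -> R).
Hypothesis m_gt0 : forall n, (0 < m n)%N.
Hypothesis m_dvd : forall n, (m n %| m n.+1)%N.
Hypothesis eta_small : forall e : R, 0 < e -> exists N,
  forall n, (N <= n)%N -> eta n < e.
Hypothesis zP : forall n, almost_periodic f (eta n) z 0 (m n).

(** The future level-n cylinder sets of the odometer. *)
Definition residue_closure n c :=
  closure [set iter i f z | i in [set i | i = c %[mod m n]]].

Local Notation U := residue_closure.

Lemma residue_closure_self n c : U n c (iter c f z).
Proof. by apply: subset_closure; exists c. Qed.

Lemma residue_closure_mod n c c' : c = c' %[mod m n] -> U n c = U n c'.
Proof.
move=> cc'; rewrite /residue_closure; congr (closure (_ @` _)).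
by apply/seteqP; split=> i /= ->.
Qed.

Lemma residue_closureS n N c : (n <= N)%N -> U N c `<=` U n c.
Proof.
move=> nN; apply: closureS => _ [i /= iE <-]; exists i => //=.
by rewrite -(modn_dvdm i (dvdn_homo m_dvd nN)) iE modn_dvdm //; exact: dvdn_homo.
Qed.

Lemma residue_closure_iter n c k w : U n c w -> U n (c + k) (iter k f w).
Proof.
move=> /closure_mdistP Uw; apply/closure_mdistP => e e0.
have [r r0 wr] := continuous_mdist w (@continuous_iter _ _ _ k cf) e0.
have [_ [i /= iE <-] /wr] := Uw _ r0; rewrite -iterD addnC => wi.
exists (iter (i + k) f z) => //; exists (i + k)%N => //=.
by rewrite -modnDml iE modnDml.
Qed.

Lemma residue_closure_near n c w : U n c w -> mdist (iter c f z) w <= eta n.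
Proof.
move=> /closure_mdistP Uw; apply/ler_addgt0Pr => e e0.
have [_ [i /= iE <-] wi] := Uw _ e0.
rewrite (le_trans (metric_triangle _ (iter i f z) _)) // lerD //.
  by apply: zP => //; rewrite iE.
by rewrite metric_sym ltW.
Qed.

(** A level-n set has diameter at most twice [eta n], so its classes at all levels determine a
    point. *)
Lemma residue_closure_sep w w' :
  (forall n, exists c, U n c w /\ U n c w') -> w = w'.
Proof.
move=> ww'; apply: (@mdist_positivity R); apply/le_anti; rewrite mdist_ge0 andbT.
apply/ler_addgt0Pl => e e0; rewrite addr0.
have [N /(_ N (leqnn _)) Ne] := eta_small (divr_gt0 e0 (ltr0n _ 2)).
have [c [/residue_closure_near wc /residue_closure_near w'c]] := ww' N.
rewrite (le_trans (metric_triangle _ (iter c f z) _)) // metric_sym; lra.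
Qed.

(** Splitting [I] by residues modulo [m N] gives finitely many pieces, and a finite union of closed
    sets is closed. *)
Lemma residue_closure_refine N (I : set nat) w :
  closure [set iter i f z | i in I] w -> exists2 c, I c & U N c w.
Proof.
pose J := [set r | (r < m N)%N /\ exists2 i, I i & i = r %[mod m N]].
have /closed_bigcup clU : finite_set J.
  by apply: (@sub_finite_set _ _ `I_(m N)) => [r []//|]; exact: finite_II.
have {}clU : closed (\bigcup_(r in J) U N r).
  by apply: clU => r _; exact: closed_closure.
have IU : [set iter i f z | i in I] `<=` \bigcup_(r in J) U N r.
  move=> _ [i Ii <-]; exists (i %% m N)%N.
    by split; [exact: ltn_pmod|exists i => //; rewrite modn_mod].
  rewrite (_ : U N _ = U N i); first exact: residue_closure_self.
  by apply: residue_closure_mod; rewrite modn_mod.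
move=> /(closureS IU) /clU [r [_ [i Ii ir]]] Uw.
by exists i => //; rewrite (residue_closure_mod ir).
Qed.

(* [w] lies in a class modulo [m N] as well, for any [N >= n]; moving along the
   orbit of [w] one returns to the class of [z] modulo [m N], hence close to
   any prescribed [iter i f z]. *)
Lemma residue_closure_sub n c c' w : U n c w -> U n c' w -> U n c `<=` U n c'.
Proof.
move=> Uw U'w; have clU' : closed (U n c') by exact: closed_closure.
suff : [set iter i f z | i in [set i | i = c %[mod m n]]] `<=` U n c'.
  by move=> /closureS /subset_trans; exact.
move=> _ [i /= ic <-]; apply: clU'; apply/closure_mdistP => e e0.
have [M Me] := eta_small e0; pose N := maxn n M.
have [c0 /= c0c Uc0] := residue_closure_refine N Uw.
have mnN := dvdn_homo m_dvd (leq_maxl n M : (n <= N)%N).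
(* The term [c0 * m N] keeps the truncated subtraction exact. Moving by [k] turns class c0 into
   class i modulo [m N] and preserves classes modulo [m n]. *)
pose k := (c0 * m N + i - c0)%N.
have c0k : (c0 + k = c0 * m N + i)%N.
  by rewrite subnKC // (leq_trans (leq_pmulr c0 (m_gt0 N))) // leq_addr.
exists (iter k f w).
  have := residue_closure_iter (k := k) U'w; rewrite (_ : U n _ = U n c') //.
  apply: residue_closure_mod.
  have /eqP : (c0 + k = c0 + 0 %[mod m n])%N.
    by rewrite c0k -(divnK mnN) mulnA modnMDl ic addn0 c0c.
  by rewrite eqn_modDl mod0n => /eqP k0; rewrite -modnDmr k0 addn0.
apply: le_lt_trans (Me N (leq_maxr _ _)).
apply: residue_closure_near; have := residue_closure_iter (k := k) Uc0.
by rewrite c0k (@residue_closure_mod _ _ i) // modnMDl.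
Qed.

Lemma residue_closure_eq n c c' w : U n c w -> U n c' w -> U n c = U n c'.
Proof.
by move=> Uw U'w; apply/seteqP; split; apply: residue_closure_sub; eassumption.
Qed.

(** Different residues modulo [m n] may have equal closures, so the exact period [d n] replaces
    [m n]. For divisibility, [z] lies in the level-(n+1) set of index [d n.+1], hence in the level-n
    set of that index, which then equals the one of index 0. *)
Lemma residue_period : exists d : nat -> nat, [/\
  forall n, (0 < d n)%N, forall n, (d n %| d n.+1)%N &
  forall n c c', U n c = U n c' <-> c = c' %[mod d n]].
Proof.
have /choice[d dP] : forall n, exists d, (0 < d)%N /\
    forall c c', U n c = U n c' <-> c = c' %[mod d].
  move=> n; have [||||||d d0 dP] := @shift_invariant_equivalence
    (fun c c' => U n c = U n c') (m n); rewrite ?m_gt0 //.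
  - by move=> i j k ->.
  - move=> i j k ij; apply: (@residue_closure_eq _ _ _ (iter (k + i) f z)).
      by rewrite addnC; exact: residue_closure_self.
    rewrite iterD; apply: residue_closure_iter; rewrite -ij.
    exact: residue_closure_self.
  - by apply: residue_closure_mod; rewrite modnn mod0n.
  - by exists d.
exists d; split=> [n|n|n]; [exact: (dP n).1| |exact: (dP n).2].
have /((dP n.+1).2 0%N (d n.+1)).2 Ud : 0 = d n.+1 %[mod d n.+1].
  by rewrite modnn mod0n.
have Uz : U n.+1 (d n.+1) z by rewrite -Ud; exact: residue_closure_self 0%N.
have /((dP n).2 0%N (d n.+1)).1 : U n 0%N = U n (d n.+1).
  apply: (@residue_closure_eq _ _ _ z); first exact: residue_closure_self n 0%N.
  exact: residue_closureS (leqnSn n) _ Uz.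
by rewrite mod0n /dvdn => <-.
Qed.

(** * The orbit closure as a periodic orbit or an odometer *)

Local Notation S := (closure (range (fun i => iter i f z))).

Lemma orbit_closure_invariant : invariant_set f S.
Proof.
move=> _ [w /closure_mdistP Sw <-]; apply/closure_mdistP => e e0.
have [r r0 wr] := continuous_mdist w cf e0.
by have [_ [i _ <-] /wr wi] := Sw _ r0; exists (iter i.+1 f z) => //; exists i.+1.
Qed.

Lemma residue_closure_orbit n c : U n c `<=` S.
Proof. by apply: closureS => _ [i _ <-]; exists i. Qed.

Lemma orbit_closure_periodic p : (0 < p)%N -> iter p f z = z ->
  is_periodic_orbit f S.
Proof.
move=> p0 fpz.
have fpz_mul q : iter (q * p) f z = z by elim: q => // q; rewrite mulSn iterD => ->.
have orbE : range (fun i => iter i f z) = [set iter k f z | k in [set k | (k < p)%N]].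
  apply/seteqP; split=> _ [i ip <-]; last by exists i.
  exists (i %% p)%N; first exact: ltn_pmod.
  by rewrite {2}(divn_eq i p) addnC iterD fpz_mul.
have SE : S = [set iter k f z | k in [set k | (k < p)%N]].
  have /accessible_finite_set_closed closedX : accessible_space X.
    exact/hausdorff_accessible/metric_hausdorff.
  rewrite orbE -((closure_id _).1 _) //.
  apply: closedX; apply: finite_image; exact: finite_II.
split; [exact: closed_closure|exact: orbit_closure_invariant|].
by exists z, p; split=> //; apply: subset_closure; exists 0%N.
Qed.

Lemma orbit_closure_odometer : (forall p, (0 < p)%N -> iter p f z <> z) ->
  compact [set: X] -> is_odometer f S.
Proof.
move=> fz cX; have [d [d0 dS UE]] := residue_period.
(* If [d n] is [k], then [iter k f z] lies in the class of [z], within [eta n] of it; aperiodicity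
   excludes this for large n. Hence [d] tends to infinity. *)
have d_neq k : (0 < k)%N -> exists N, forall n, (N <= n)%N -> d n != k.
  move=> k0; have /eta_small[N Ne] : 0 < mdist (iter k f z) z.
    by rewrite mdist_gt0; exact/eqP/fz.
  exists N => n /Ne; apply: contraTneq => dnk; rewrite -leNgt.
  apply: residue_closure_near; rewrite -dnk -(UE n 0%N (d n)).2 ?modnn ?mod0n //.
  exact: residue_closure_self n 0%N.
have d_ge A : exists N, forall n, (N <= n)%N -> (A <= d n)%N.
  elim: A => [|A [N AN]]; first by exists 0%N.
  case: (posnP A) => [->|A0]; first by exists 0%N.
  have [N' AN'] := d_neq _ A0; exists (maxn N N') => n.
  rewrite geq_max => /andP[Nn N'n].
  by rewrite ltn_neqAle eq_sym AN' // AN.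
have dcvg : d @ \oo --> \oo.
  by move=> P [A _ AP]; have [N NA] := d_ge A; exists N => // n /= /NA /AP.
have dhomo : {homo d : i j / (i <= j)%N >-> (i <= j)%N}.
  apply: homo_leq => [//|k l n|n]; first exact: leq_trans.
  exact: dvdn_leq.
pose D := PeriodicStructure d0 dhomo dS dcvg.
split; first exact: closed_closure.
exists orbit_closure_invariant, D.
have code_uniq n (c c' : 'I_(d n)) w : U n c w -> U n c' w -> c = c'.
  move=> Uc Uc'; apply/val_inj => /=.
  rewrite -(modn_small (ltn_ord c)) -(modn_small (ltn_ord c')).
  exact/UE/(residue_closure_eq Uc Uc').
have Umod n c : U n (c %% d n) = U n c by apply/UE; rewrite modn_mod.
(* A compatible sequence of residues selects nested closed sets; a cluster point of [iter (t n) f z]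
   lies in all of them. *)
have /choice[h hP] : forall t : @odometer_space D, exists w : S,
    forall n, U n (val t n : 'I_(d n)) (val w).
  case=> t /= /set_mem tD.
  have tN n N : (n <= N)%N -> (t N : 'I_(d N)) = (t n : 'I_(d n)) %[mod d n].
    elim: N => [|N IHN]; first by rewrite leqn0 => /eqP ->.
    rewrite leq_eqVlt => /predU1P[-> //|/[dup] nN /IHN <-].
    rewrite -[LHS](modn_dvdm _ (dvdn_homo dS (nN : n <= N)%N)) -(tD N).
    by rewrite modn_dvdm //; exact: dvdn_homo.
  have [w wP] := compact_frequently_near (fun n => iter (t n : 'I_(d n)) f z) cX.
  have Uw n : U n (t n : 'I_(d n)) w.
    suff : closure (U n (t n : 'I_(d n))) w by exact: closed_closure.
    apply/closure_mdistP => e e0.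
    have [N nN wN] := wP e n e0; exists (iter (t N : 'I_(d N)) f z) => //.
    have -> : U n (t n : 'I_(d n)) = U n (t N : 'I_(d N)) by apply/UE/esym/tN.
    exact: residue_closure_self.
  by exists (exist _ w (mem_set (residue_closure_orbit (Uw 0%N)))).
have code_ex (w : S) n : exists c : 'I_(d n), U n c (val w).
  case: w => w /= /set_mem /(residue_closure_refine n) [c _ Uw].
  by exists (Ordinal (ltn_pmod c (d0 n))); rewrite /= Umod.
pose k0 w n : 'I_(d n) := projT1 (cid (code_ex w n)).
have k0P w n : U n (k0 w n) (val w) by rewrite /k0; case: cid.
have k0D w : @odometer_space D (k0 w).
  move=> n.
  apply/UE.
  apply: (residue_closure_eq (k0P w n)).
  exact: residue_closureS (leqnSn n) _ (k0P w n.+1).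
pose k w : @odometer_space D := exist _ (k0 w) (mem_set (k0D w)).
have kP w n : U n (val (k w) n : 'I_(d n)) (val w) by exact: k0P.
have hK : cancel h k.
  move=> t; apply/val_inj/functional_extensionality_dep => n.
  exact: code_uniq (kP _ _) (hP _ _).
have kK : cancel k h.
  move=> w; apply/val_inj/residue_closure_sep => n.
  by exists (val (k w) n : 'I_(d n)).
exists h; last first.
  (* Both sides lie in the class of index [t n + 1] at every level n. *)
  apply/funext => t; apply/val_inj/residue_closure_sep => n.
  exists (val t n : 'I_(d n)).+1; split.
    by rewrite -addn1; apply: residue_closure_iter; exact: hP.
  by have := hP (odometer_map t) n; rewrite /= Umod.
split; last (exists k; split=> //).
(* Fixing one coordinate n is an open condition and keeps the image within twice [eta n]. *)
- apply: continuous_comp_initial => t A /nbhs_mdistP[e e0 tA].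
  have [n /(_ n (leqnn n)) ne] := eta_small (divr_gt0 e0 (ltr0n _ 2)).
  have : nbhs t [set t' : @odometer_space D | val t' n = val t n].
    have /(_ [set val t n]) :=
      @proj_continuous _ (fun j => discrete_topology 'I_(D j)) n (val t).
    move=> /(_ (discrete_set1 _)) tn.
    pose incl := set_val : @odometer_space D -> odometer_ambient D.
    exact: (@initial_continuous _ _ incl t _ tn).
  apply: filterS => t' /= t't; apply: tA => /=.
  have := residue_closure_near (hP t n); have := residue_closure_near (hP t' n).
  rewrite (t't : val t' n = val t n) => near' near.
  apply: le_lt_trans (metric_triangle _ (iter (val t n : 'I_(d n)) f z) _) _.
  rewrite (splitr e) ltrD //; last exact: le_lt_trans ne.
  by rewrite metric_sym; exact: le_lt_trans ne.
(* The finitely many other level-n classes have a closed union that misses [w]. *)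
- have locally_const n w : nbhs w [set w' : S | k0 w' n = k0 w n].
    pose V := \bigcup_(c in [set c : 'I_(d n) | c != k0 w n]) U n c.
    have clV : closed V.
      by apply: closed_bigcup => [|c _]; [exact: finite_finset|exact: closed_closure].
    have : nbhs w (set_val @^-1` ~` V).
      apply: (@initial_continuous _ _ set_val w); apply: open_nbhs_nbhs; split.
        exact: closed_openC.
      by case=> c /= /eqP cw Uc; apply: cw; exact: code_uniq Uc (k0P _ _).
    apply: filterS => w' /= Vw'; apply/eqP/negPn/negP => cw.
    by apply: Vw'; exists (k0 w' n) => //; exact: k0P.
  apply: continuous_comp_initial => w; apply/cvg_sup.
    by apply: fmap_filter; exact: nbhs_filter.
  move=> n A [B [[C _ <-] Cw] CA]; apply: filterS (locally_const n w) => w' ww'.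
  by apply: CA; rewrite -[(_ @^-1` _) _]/(C (k0 w' n)) (ww' : k0 w' n = k0 w n).
Qed.

End RegularOrbit.

Theorem theorem1p2 (R : realType) (X : metricType R) (f : X -> X)
    (compactX : compact [set: X]) (continuousf : continuous f)
    (shadowingf : shadowing_property f) :
  [set: X] = closure (omega_regular_points f).
Proof.
apply/esym; rewrite -subTset => x _; apply/closure_mdistP => e e0.
have e20 : 0 < e / 2 by rewrite divr_gt0.
have [y [a [m [xy m0 mS yP]]]] := exists_regular compactX shadowingf x continuousf e20.
have exp_small (r : R) : 0 < r -> exists N,
    forall n, (N <= n)%N -> e / 2 / 2 ^+ n < r.
  (* Archimedean bound together with n < 2^n. *)
  move=> r0; exists (Num.bound (e / 2 / r)) => n nN.
  rewrite ltr_pdivrMr ?exprn_gt0 // [ltRHS]mulrC -ltr_pdivrMr //.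
  apply: lt_le_trans (archi_boundP (ltW (divr_gt0 e20 r0))) _.
  by rewrite -natrX ler_nat (leq_trans nN) // ltnW // ltn_expl.
have exp2_small (r : R) : 0 < r ->
    exists N, forall n, (N <= n)%N -> (e / 2 / 2 ^+ n) *+ 2 < r.
  move=> r0; have [N Nr] := exp_small _ (divr_gt0 r0 (ltr0n _ 2)).
  by exists N => n /Nr; move: (e / 2 / 2 ^+ n) => s; lra.
have [z yz zP] := omega_limit_almost_periodic continuousf compactX m0 mS exp_small yP.
(* The point near [x] is [y]; [z] only generates its omega-limit set and need not be close to
   [x]. *)
exists y; last by apply: le_lt_trans xy _; lra.
rewrite /omega_regular_points /= yz.
case: (pselect (exists2 p, (0 < p)%N & iter p f z = z)) => [[p p0 fpz]|zN].
  by left; exact: orbit_closure_periodic p0 fpz.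
right; apply: (orbit_closure_odometer continuousf m0 mS exp2_small zP) => // p p0 fpz.
by apply: zN; exists p.
Qed.
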